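(* Let $G$ be a finite simple graph on $d$ vertices, with chromatic polynomial $\chi_G(n)$, and let $h_G(z)$ be the polynomial such that $$\sum_{n=0}^{\infty} \chi_G(n) z^n = \frac{h_G(z)}{(1-z)^{d+1}}.$$ Then the polynomial $z h_G(z)$ can be decomposed as $z h_G(z) = a(z) + z\, b(z)$, where $a$ and $b$ are polynomials satisfying $a(z) = z^{d+1} a\left(\frac{1}{z}\right)$ and $b(z) = z^{d} b\left(\frac{1}{z}\right)$, and such that $b(z)$ and $-a(z)$ have nonnegative coefficients.
   Context: The chromatic polynomial $\chi_G(n)$ counts the maps $\phi: V \to \{1, \ldots, n\}$ on the vertex set $V$ of $G$ such that $\phi(v) \ne \phi(w)$ whenever $vw$ is an edge of $G$. *)

(* Defs.v *)
From mathcomp Require Import all_boot all_order all_algebra.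
Set Implicit Arguments.
Unset Strict Implicit.
Unset Printing Implicit Defensive.

Import GRing.Theory.
Local Open Scope ring_scope.

Definition proper_coloring (V : finType) (e : rel V) (n : nat)
    (f : {ffun V -> 'I_n}) : bool :=
  [forall v, forall w, e v w ==> (f v != f w)].

(* The value at n of the chromatic polynomial; the colors 1, ..., n are
   represented by 'I_n. *)
Definition chromatic (V : finType) (e : rel V) (n : nat) : nat :=
  #|[set f : {ffun V -> 'I_n} | proper_coloring e f]|.

(* The identity \sum_n (u n) z^n = p(z) / q(z) of formal power series, meant
   for q invertible as a power series (q`_0 a unit): the Cauchy product of the
   series of u with q is p. *)
Definition gen_series_eq_frac (R : nzRingType) (u : nat -> R)
    (p q : {poly R}) : Prop :=
  forall m : nat, \sum_(i < m.+1) u i * q`_(m - i) = p`_m.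

(* p(z) = z^k p(1/z), as functions of z <> 0; over an infinite field this is
   the same as the identity of rational functions. *)
Definition self_reciprocal (R : fieldType) (k : nat) (p : {poly R}) : Prop :=
  forall z : R, z != 0 -> p.[z] = z ^+ k * p.[z^-1].

(* Main.v *)
Require Import Defs.
From mathcomp Require Import all_boot all_order all_algebra.
From mathcomp Require Import zify ring.
Set Implicit Arguments.
Unset Strict Implicit.
Unset Printing Implicit Defensive.

Import Order.TTheory GRing.Theory Num.Theory.
Local Open Scope ring_scope.

(* Write h_j for the coefficients of h and g_i = \sum_(j < i) (h_(d-j) - h_j).
   The decomposition is forced: - a = \sum_i g_i z^i and
   b = \sum_i (g_i + h_(d-i)) z^i.  So one needs h_j >= 0 and g_i >= 0.

   h_j >= 0: the coefficient h_j is the (d+1)-st backward difference at j of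
   the chromatic polynomial.  Colorings split by the acyclic orientation they
   induce; for a fixed orientation, totally order the vertices by (color, w)
   with w decreasing along the edges, and remove the largest vertex.  This
   writes the backward difference of the count as a sum of counts of the same
   kind, possibly delayed by one, with one vertex less.

   g_i >= 0: deletion-contraction gives
   g_i(G) = g_i(G - e) + h_(i-1)(G / e) + h_(d-i)(G / e), and for the edgeless
   graph with d > 0, h is an Eulerian polynomial, whose symmetry makes
   g_i = h_i. *)

(** * Backward differences of sequences *)

Definition delay {R : zmodType} (u : nat -> R) (n : nat) : R :=
  if n is n'.+1 then u n' else 0.

Definition bdiff {R : zmodType} (u : nat -> R) (n : nat) : R :=
  u n - delay u n.

(** Differences look only at earlier indices. This locality makes formulas usable that hold only up
    to a bound on the number of colors. *)
Lemma eq_iter_bdiff (R : zmodType) (u v : nat -> R) k m :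
  (forall i, (i <= m)%N -> u i = v i) -> iter k bdiff u m = iter k bdiff v m.
Proof.
move=> uv; elim: k m uv => [|k IHk] m uv /=; first exact: uv.
rewrite /bdiff IHk //; congr (_ - _); case: m uv => //= m uv.
by apply: IHk => i le_im; apply: uv; apply: leqW.
Qed.

Lemma iter_bdiff_delay (R : zmodType) (u : nat -> R) k m :
  iter k bdiff (delay u) m = delay (iter k bdiff u) m.
Proof.
elim: k m => //= k IHk [|m]; rewrite /bdiff /= !IHk //=.
by rewrite subr0.
Qed.

Lemma iter_bdiffD (R : zmodType) (u v : nat -> R) k m :
  iter k bdiff (fun n => u n + v n) m = iter k bdiff u m + iter k bdiff v m.
Proof.
elim: k m => //= k IHk [|m]; rewrite /bdiff /= !IHk ?subr0 //.
by rewrite opprD addrACA.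
Qed.

Lemma iter_bdiffN (R : zmodType) (u : nat -> R) k m :
  iter k bdiff (fun n => - u n) m = - iter k bdiff u m.
Proof.
elim: k m => //= k IHk [|m]; rewrite /bdiff /= !IHk ?subr0 //.
by rewrite opprD.
Qed.

Lemma iter_bdiff0 (R : zmodType) k m : iter k bdiff (fun=> 0 : R) m = 0.
Proof. by elim: k m => //= k IHk [|m]; rewrite /bdiff /= !IHk subr0. Qed.

Lemma iter_bdiff_sum (R : zmodType) (I : Type) (r : seq I) (P : pred I)
    (u : I -> nat -> R) k m :
  iter k bdiff (fun n => \sum_(i <- r | P i) u i n) m =
  \sum_(i <- r | P i) iter k bdiff (u i) m.
Proof.
elim: r => [|i r IHr].
  rewrite big_nil -[RHS](iter_bdiff0 R k m).
  by apply: eq_iter_bdiff => n _; rewrite big_nil.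
rewrite big_cons; case: ifP => Pi.
  rewrite -IHr -iter_bdiffD.
  by apply: eq_iter_bdiff => n _; rewrite big_cons Pi.
by rewrite -IHr; apply: eq_iter_bdiff => n _; rewrite big_cons Pi.
Qed.

(** Multiplying a generating series by 1 - z is [bdiff] on its coefficients; this identifies the
    coefficients of [h]. *)
Lemma iter_bdiff_conv (R : nzRingType) (u : nat -> R) k m :
  \sum_(i < m.+1) u i * ((1 - 'X) ^+ k)`_(m - i) = iter k bdiff u m.
Proof.
elim: k m => [|k IHk] m.
  rewrite (bigD1 ord_max) //= subnn coef1 mulr1 big1 ?addr0 // => i ne_i.
  by rewrite coef1 subn_eq0 leqNgt ltn_neqAle -ltnS ltn_ord ne_i mulr0.
rewrite /= /bdiff -IHk; case: m => [|m].
  by rewrite !big_ord1 subr0 exprSr mulrBr mulr1 coefB coefMX subr0.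
rewrite /= -IHk big_ord_recr [in RHS]big_ord_recr /= subnn exprSr mulrBr mulr1.
rewrite coefB coefMX /= subr0 [RHS]addrAC; congr (_ + _).
rewrite -sumrB; apply: eq_bigr => i _.
by rewrite coefB coefMX subSn ?leq_ord //= mulrBr.
Qed.

(** Iterated Leibniz rule, from n u(n) - (n-1) u(n-1) = n (u(n) - u(n-1)) + u(n-1). *)
Lemma iter_bdiffMn (R : comNzRingType) (u : nat -> R) k m :
  iter k.+1 bdiff (fun n => n%:R * u n) m =
  m%:R * iter k.+1 bdiff u m + k.+1%:R * delay (iter k bdiff u) m.
Proof.
elim: k m => [|k IHk] m.
  by case: m => [|m]; rewrite /= /bdiff /=; ring.
have bS (v : nat -> R) i : bdiff v i.+1 = v i.+1 - v i by [].
rewrite iterS; case: m => [|m].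
  by rewrite /bdiff IHk /= !mul0r !mulr0 subr0.
rewrite bS !IHk (iterS k.+1) bS iterS; move: (iter k bdiff u) => v.
by rewrite bS /bdiff /=; ring.
Qed.

(** * Eulerian numbers, the edgeless case *)

Definition eulerian (R : nzRingType) (d : nat) : nat -> R :=
  iter d.+1 bdiff (fun n => (n ^ d)%:R).

(** The Leibniz rule applied to n * n^d. For d > 0, entry m is the number of permutations of d
    letters with m - 1 descents. *)
Lemma eulerianS (R : comNzRingType) d m :
  eulerian R d.+1 m =
  m%:R * eulerian R d m + (d.+2%:R - m%:R) * delay (eulerian R d) m.
Proof.
rewrite /eulerian.
rewrite (eq_iter_bdiff (v := fun n => n%:R * (n ^ d)%:R)); last first.
  by move=> i _; rewrite expnS natrM.
by rewrite iter_bdiffMn iterS {1}/bdiff; ring.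
Qed.

Lemma eulerian00 (R : comNzRingType) m : eulerian R 0 m = (m == 0)%:R.
Proof. by rewrite /eulerian /bdiff; case: m => [|m] /=; rewrite ?subr0 ?subrr. Qed.

Lemma eulerian_gt (R : comNzRingType) d m : (d < m)%N -> eulerian R d m = 0.
Proof.
elim: d m => [|d IHd] [|m] // lt_dm; first by rewrite eulerian00.
by rewrite eulerianS /= !IHd ?(ltnW lt_dm) // !mulr0 addr0.
Qed.

(** Induction on [d]: reflection exchanges the two terms of the recurrence [eulerianS]. At both ends
    of the range the values are 0. *)
Lemma eulerian_sym (R : comNzRingType) d j :
  (j <= d.+2)%N -> eulerian R d.+1 j = eulerian R d.+1 (d.+2 - j).
Proof.
have e0 k : eulerian R k.+1 0 = 0 by rewrite eulerianS /= mul0r mulr0 addr0.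
elim: d j => [|d IHd] [|j] le_jd.
- by rewrite subn0 e0 eulerian_gt.
- by case: j le_jd => [|[|]]; rewrite // subnn e0 eulerian_gt.
- by rewrite subn0 e0 eulerian_gt.
move: le_jd; rewrite ltnS leq_eqVlt => /orP[/eqP ->|lt_jd].
  by rewrite subnn e0 eulerian_gt.
have [k def_d] : exists k, d.+1 = (j + k)%N by exists (d.+1 - j)%N; lia.
rewrite [LHS]eulerianS /= (IHd j) ?(IHd j.+1); [|lia..].
have -> : (d.+2 - j = k.+1)%N by lia.
have -> : (d.+2 - j.+1 = k)%N by lia.
have -> : (d.+3 - j.+1 = k.+1)%N by lia.
rewrite [RHS]eulerianS /=.
have -> : d.+3 = (j + k + 2)%N by lia.
by ring.
Qed.

(** * Counting increasing maps below a lexicographic threshold *)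

(* Maps on A (extended by 0, with all values in a common 'I_N.+1) for which
   every (f u, w u) is lexicographically below (n, b), and which are strictly
   increasing along D. *)
Definition lex_maps (V : finType) (D : rel V) (w : V -> nat) (N : nat)
    (A : {set V}) (b n : nat) : {set {ffun V -> 'I_N.+1}} :=
  [set f : {ffun V -> 'I_N.+1} |
    [forall u, if u \in A then ((f u < n) || ((f u == n :> nat) && (w u < b)))%N
               else f u == 0 :> nat] &&
    [forall x in A, forall y in A, D x y ==> (f x < f y)%N]].

Lemma lex_mapsP (V : finType) (D : rel V) (w : V -> nat) N (A : {set V}) b n
    (f : {ffun V -> 'I_N.+1}) :
  reflect [/\ forall u, u \in A -> (f u < n)%N \/ f u = n :> nat /\ (w u < b)%N,
              forall u, u \notin A -> f u = 0 :> nat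
            & forall x y, x \in A -> y \in A -> D x y -> (f x < f y)%N]
          (f \in lex_maps D w N A b n).
Proof.
rewrite inE; apply: (iffP andP) => [[/forallP fA /forall_inP fD]|[fA f0 fD]].
  split=> [u uA|u /negbTE uA|x y xA yA Dxy]; first 2 last.
  - by have /forall_inP/(_ y yA)/implyP := fD x xA; apply.
  - have := fA u; rewrite uA => /orP[]; first by left.
    by case/andP=> /eqP-> ->; right.
  - by have := fA u; rewrite uA => /eqP.
split; last by do 2![apply/forall_inP => ? ?]; apply/implyP; apply: fD.
apply/forallP => u; case: ifP => uA; last by rewrite f0 ?uA.
by case: (fA u uA) => [->//|[-> ->]]; rewrite eqxx orbT.
Qed.

Lemma lex_maps_set0 (V : finType) (D : rel V) (w : V -> nat) N b n :
  #|lex_maps D w N set0 b n| = 1%N.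
Proof.
apply/eqP/cards1P; exists [ffun=> ord0]; apply/setP => f; rewrite inE.
apply/lex_mapsP/eqP => [[_ f0 _]|->].
  by apply/ffunP => u; apply/val_inj; rewrite ffunE /= f0 ?inE.
by split=> [u|u _|x y]; rewrite ?inE ?ffunE.
Qed.

Lemma lex_maps00 (V : finType) (D : rel V) (w : V -> nat) N (A : {set V}) :
  A != set0 -> #|lex_maps D w N A 0 0| = 0%N.
Proof.
case/set0Pn => v vA; apply/eqP; rewrite cards_eq0; apply/set0Pn => -[f].
by case/lex_mapsP => /(_ v vA) [|[]].
Qed.

(** The carry of the threshold from (n, b) to (n + 1, 0), which links consecutive values of [n]. *)
Lemma lex_maps_bound (V : finType) (D : rel V) (w : V -> nat) N (A : {set V}) b n :
  (forall v, w v < b)%N -> lex_maps D w N A 0 n.+1 = lex_maps D w N A b n.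
Proof.
move=> wb; apply/setP => f; apply/lex_mapsP/lex_mapsP => -[fA f0 fD]; split=> // u uA.
  by case: (fA u uA) => [|[] //]; rewrite ltnS leq_eqVlt => /orP[/eqP|]; [right|left].
by left; case: (fA u uA) => [/ltnW|[->]].
Qed.

Lemma lex_maps_skip (V : finType) (D : rel V) (w : V -> nat) N (A : {set V}) b n :
  (forall v, v \in A -> w v <> b) ->
  lex_maps D w N A b.+1 n = lex_maps D w N A b n.
Proof.
move=> wb; apply/setP => f; apply/lex_mapsP/lex_mapsP => -[fA f0 fD]; split=> // u uA.
  by have := wb u uA; case: (fA u uA) => [|[]]; [left|right; split=> //; lia].
by case: (fA u uA) => [|[]]; [left|right; split=> //; lia].
Qed.

(* When a pair (n, w v) becomes allowed, the new maps have f v = n, and then v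
   is their largest vertex for the order by (f u, w u). *)
Lemma card_lex_maps_step (V : finType) (D : rel V) (w : V -> nat) N
    (A : {set V}) v n :
  injective w -> (forall x y, D x y -> (w y < w x)%N) -> (n <= N)%N -> v \in A ->
  #|lex_maps D w N A (w v).+1 n| =
  (#|lex_maps D w N A (w v) n| +
   if [forall u in A, ~~ D v u] then #|lex_maps D w N (A :\ v) (w v) n| else 0)%N.
Proof.
move=> w_inj Dw le_nN vA.
rewrite -(cardsID [set f : {ffun V -> 'I_N.+1} | f v == n :> nat]) addnC.
congr (_ + _)%N.
  apply: eq_card => f; rewrite !in_setD inE.
  apply/andP/lex_mapsP => [[fv /lex_mapsP[fA f0 fD]]|[fA f0 fD]].
    split=> // u uA; case: (fA u uA) => [|[fu wu]]; [by left|right; split=> //].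
    rewrite ltnNge leq_eqVlt negb_or -leqNgt -ltnS wu andbT.
    by apply: contraNneq fv => /w_inj ->; rewrite fu.
  split; first by case: (fA v vA) => [|[_]]; rewrite ?ltnn // => /ltn_eqF ->.
  apply/lex_mapsP; split=> // u uA.
  by case: (fA u uA) => [|[? /ltnW]]; [left|right].
(* If [v] has a [D]-successor in [A], that vertex would need a value above n, so no new map
   arises. *)
case: ifPn => [/forall_inP vmax | /forall_inPn[u uA /negbNE Dvu]]; last first.
  apply/eqP; rewrite cards_eq0; apply/set0Pn => -[f]; rewrite inE.
  case/andP=> /lex_mapsP[fA _ fD]; rewrite inE => /eqP fv.
  by have := fD v u vA uA Dvu; case: (fA u uA) => [|[]]; lia.
pose put (f : {ffun V -> 'I_N.+1}) := [ffun u => if u == v then inord n else f u].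
have put_inj : {in lex_maps D w N (A :\ v) (w v) n &, injective put}.
  move=> f g /lex_mapsP[_ f0 _] /lex_mapsP[_ g0 _] /ffunP fg; apply/ffunP => u.
  have := fg u; rewrite !ffunE; case: eqP => // -> _.
  by apply/val_inj; rewrite /= f0 ?g0 ?inE ?eqxx.
rewrite -(card_in_imset put_inj); apply: eq_card => f.
apply/setIP/imsetP => [[/lex_mapsP[fA f0 fD]]|[g /lex_mapsP[gA g0 gD] ->]].
  rewrite inE => /eqP fv; exists [ffun u => if u == v then ord0 else f u].
    apply/lex_mapsP; split=> [u|u|x y]; rewrite !inE ?ffunE.
    - case: eqP => //= uv uA; case: (fA u uA) => [|[fu]]; first by left.
      rewrite ltnS leq_eqVlt => /orP[/eqP/w_inj //|wu]; by right.
    - by case: eqP => //= _; apply: f0.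
    by case: eqP => // _ /= xA; case: eqP => // _ /= yA; apply: fD.
  apply/ffunP => u; rewrite !ffunE; case: eqP => // ->.
  by apply/val_inj; rewrite /= inordK ?fv.
rewrite inE ffunE eqxx inordK ?eqxx ?ltnS //; split=> //.
apply/lex_mapsP; split=> [u uA|u uA|x y xA yA Dxy]; rewrite !ffunE.
- case: eqP => [->|/eqP uv]; first by right; rewrite inordK.
  by case: (gA u) => [|?|[? /ltnW]]; rewrite ?inE ?uv //; [left|right].
- by case: eqP => [uv|/eqP uv]; [rewrite uv vA in uA|rewrite g0 // !inE uv].
have ne_xv : x != v by apply: contraTneq Dxy => ->; apply: vmax.
rewrite (negPf ne_xv); case: eqP => [yv|/eqP ne_yv]; last first.
  by apply: gD; rewrite ?inE ?ne_xv ?ne_yv.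
(* Here [w x] exceeds [w v], so the lexicographic bound leaves only [g x < n]. *)
have := Dw _ _ Dxy; rewrite inordK // yv.
by case: (gA x) => [|//|[]]; [rewrite !inE ne_xv|lia].
Qed.

(** Induction on [b]: as [w] is injective, raising the threshold by one meets at most one vertex,
    and [card_lex_maps_step] or [lex_maps_skip] applies. *)
Lemma card_lex_maps_sum (V : finType) (D : rel V) (w : V -> nat) N
    (A : {set V}) b n :
  injective w -> (forall x y, D x y -> (w y < w x)%N) -> (n <= N)%N ->
  #|lex_maps D w N A b n| =
  (#|lex_maps D w N A 0 n| +
   \sum_(v in A | [forall u in A, ~~ D v u] && (w v < b))
      #|lex_maps D w N (A :\ v) (w v) n|)%N.
Proof.
move=> w_inj Dw le_nN; elim: b => [|b IHb].
  by rewrite big_pred0 ?addn0 // => v; rewrite ltn0 !andbF.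
case: (pickP (fun v => (v \in A) && (w v == b))) => [v /andP[vA /eqP wv]|no_v].
  rewrite -{1}wv card_lex_maps_step // wv IHb -addnA; congr (_ + _)%N.
  case: ifPn => vmax; last first.
    rewrite addn0; apply: eq_bigl => u; rewrite ltnS (leq_eqVlt (w u)).
    case: (eqVneq (w u) b) => [|//]; rewrite -{1}wv => /w_inj ->.
    by rewrite (negPf vmax) !andbF.
  rewrite [RHS](bigD1 v) /=; last by rewrite vA vmax wv ltnSn.
  rewrite addnC wv; congr (_ + _)%N; apply: eq_bigl => u.
  rewrite ltnS (leq_eqVlt (w u)) -(inj_eq w_inj) wv.
  by case: (ltngtP (w u) b); rewrite /= ?andbF ?andbT.
rewrite lex_maps_skip => [|v vA wv]; last by have := no_v v; rewrite vA wv eqxx.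
rewrite IHb; congr (_ + _)%N; apply: eq_bigl => v; rewrite ltnS (leq_eqVlt (w v)).
by have := no_v v; case: (v \in A) => //= ->.
Qed.

(** Between the thresholds (n - 1, b) and (n, b) the pair of each vertex is passed once: with value
    n if [w v < b], otherwise with value n - 1, hence the [delay]. *)
Lemma bdiff_card_lex_maps (R : nzRingType) (V : finType) (D : rel V)
    (w : V -> nat) N (A : {set V}) b n :
  injective w -> (forall x y, D x y -> (w y < w x)%N) -> (n <= N)%N ->
  A != set0 ->
  bdiff (fun n => #|lex_maps D w N A b n|%:R : R) n =
  \sum_(v in A | [forall u in A, ~~ D v u])
     (if (w v < b)%N then fun n => #|lex_maps D w N (A :\ v) (w v) n|%:R
      else delay (fun n => #|lex_maps D w N (A :\ v) (w v) n|%:R)) n.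
Proof.
move=> w_inj Dw le_nN A0.
pose ok v := (v \in A) && [forall u in A, ~~ D v u].
pose F v n := #|lex_maps D w N (A :\ v) (w v) n|.
have cardE b' k : (k <= N)%N -> #|lex_maps D w N A b' k|%:R =
    #|lex_maps D w N A 0 k|%:R
    + \sum_(v | ok v) (if (w v < b')%N then (F v k)%:R else 0) :> R.
  move=> le_kN; rewrite card_lex_maps_sum // natrD; congr +%R.
  rewrite -big_mkcondr -natr_sum; congr _%:R.
  by apply: eq_bigl => v; rewrite andbA.
rewrite /bdiff (cardE b) //; case: n le_nN => [|n] le_nN /=.
  by rewrite lex_maps00 // add0r subr0; apply: eq_bigr => v _; case: ifP.
have wM v : (w v < (\max_u w u).+1)%N by rewrite ltnS leq_bigmax.
rewrite (lex_maps_bound _ _ _ _ wM) cardE 1?ltnW // (cardE b) 1?ltnW //.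
rewrite addrAC [X in X - _ + _]addrC addrKA -sumrB -big_split /=.
apply: eq_bigr => v _.
by rewrite wM; case: ifP; rewrite ?subrr ?addr0 ?subr0 ?add0r.
Qed.

(** Induction on [#|A|]: one difference removes one vertex. For empty [A] the count is constantly 1,
    with difference the indicator of 0. *)
Lemma card_lex_maps_bdiff_ge0 (R : numDomainType) (V : finType) (D : rel V)
    (w : V -> nat) N (A : {set V}) b m :
  injective w -> (forall x y, D x y -> (w y < w x)%N) -> (m <= N)%N ->
  0 <= iter #|A|.+1 bdiff (fun n => #|lex_maps D w N A b n|%:R : R) m.
Proof.
move=> w_inj Dw; move Ek: #|A| => k; elim: k => [|k IHk] in A Ek b m *.
  move/cards0_eq: Ek => -> _ /=; rewrite /bdiff.
  by case: m => [|m] /=; rewrite !lex_maps_set0 ?subr0 ?subrr.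
move=> le_mN; rewrite iterSr; have A0: A != set0 by rewrite -card_gt0 Ek.
pose F v n : R := #|lex_maps D w N (A :\ v) (w v) n|%:R.
pose G v := if (w v < b)%N then F v else delay (F v).
have bdiffE n : (n <= m)%N -> bdiff (fun n => #|lex_maps D w N A b n|%:R) n =
    \sum_(v in A | [forall u in A, ~~ D v u]) G v n.
  by move=> le_nm; apply: bdiff_card_lex_maps => //; apply: leq_trans le_mN.
rewrite (eq_iter_bdiff _ bdiffE) /G /F.
rewrite iter_bdiff_sum sumr_ge0 // => v /andP[vA _].
have kAv : #|A :\ v| = k by have := cardsD1 v A; rewrite vA Ek => -[].
case: ifP => _; first exact: IHk.
by rewrite iter_bdiff_delay {bdiffE}; case: m le_mN => //= m /ltnW; apply: IHk.
Qed.

(** * Nonnegativity of the coefficients of h *)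

Lemma chromatic_widen (V : finType) (e : rel V) N n : (n <= N)%N ->
  chromatic e n =
  #|[set f : {ffun V -> 'I_N} | [forall u, f u < n]%N && proper_coloring e f]|.
Proof.
move=> le_nN; pose widen (f : {ffun V -> 'I_n}) := [ffun u => widen_ord le_nN (f u)].
have widen_inj : injective widen.
  move=> f g /ffunP fg; apply/ffunP => u; apply/val_inj.
  by have /(congr1 val) := fg u; rewrite !ffunE.
rewrite /chromatic -(card_imset _ widen_inj); apply: eq_card => f.
have widenE (g : {ffun V -> 'I_n}) u v : (widen g u == widen g v) = (g u == g v).
  by rewrite !ffunE -!val_eqE.
rewrite inE; apply/imsetP/andP => [[g]|[/forallP f_lt f_prop]].
  rewrite inE => /forallP g_prop ->; split; first by apply/forallP => u; rewrite ffunE /=.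
  by apply/forallP => u; apply/forallP => v; rewrite widenE; apply/(forallP (g_prop u)).
have def_f : f = widen [ffun u => Ordinal (f_lt u)].
  by apply/ffunP => u; apply/val_inj; rewrite !ffunE.
exists [ffun u => Ordinal (f_lt u)] => //.
rewrite inE; apply/forallP => u; apply/forallP => v.
by rewrite -widenE -def_f; apply/(forallP (forallP f_prop u)).
Qed.

Lemma chromatic_bdiff_ge0 (R : numDomainType) (V : finType) (e : rel V) m :
  0 <= iter #|V|.+1 bdiff (fun n => (chromatic e n)%:R : R) m.
Proof.
pose T := {ffun V -> 'I_m.+1}.
pose orient (f : T) : {set V * V} :=
  [set p | (e p.1 p.2 || e p.2 p.1) && (f p.1 < f p.2)%N].
pose C s n := [set f : T | [&& [forall u, f u < n]%N, proper_coloring e f & orient f == s]].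
(* By [chromatic_widen], the colorings for all n up to m live in the single type [T], where they are
   grouped by orientation. *)
have chiE n : (n <= m)%N -> (chromatic e n)%:R = \sum_s (#|C s n|%:R : R).
  move=> le_nm; rewrite (chromatic_widen _ (leqW le_nm)) -natr_sum; congr _%:R.
  rewrite -sum1_card (partition_big orient predT) //=; apply: eq_bigr => s _.
  by rewrite -sum1_card; apply: eq_bigl => f; rewrite !inE andbA.
rewrite (eq_iter_bdiff _ chiE) iter_bdiff_sum sumr_ge0 // => s _.
case: (pickP [pred f | proper_coloring e f & orient f == s])
  => [f0 /andP[]|no_f]; last first.
  rewrite (_ : iter _ _ _ _ = 0) // -[RHS](iter_bdiff0 R #|V|.+1 m).
  apply: eq_iter_bdiff => n _; rewrite (_ : C s n = set0) ?cards0 //.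
  by apply/setP => f; rewrite !inE; have /= -> := no_f f; rewrite andbF.
move=> f0_prop /eqP f0_s.
(* Any one coloring inducing the orientation s provides the tie-breaking w. *)
pose D u v := (u, v) \in s; pose w v := ((m - f0 v) * #|V| + enum_rank v)%N.
have DE u v : D u v = (e u v || e v u) && (f0 u < f0 v)%N by rewrite /D -f0_s inE.
(* [w] is a two-digit number in base [#|V|]: the reversed color under [f0], then the rank of the
   vertex. *)
have w_inj : injective w.
  move=> u v /(congr1 (modn^~ #|V|)); rewrite !modnMDl !modn_small //.
  by move/ord_inj/enum_rank_inj.
have Dw u v : D u v -> (w v < w u)%N.
  rewrite DE /w => /andP[_ lt_f0].
  have -> : (m - f0 u = (m - f0 v) + (f0 v - f0 u))%N.
    by have := ltn_ord (f0 v); lia.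
  rewrite mulnDl -addnA ltn_add2l; apply: ltn_addr.
  by apply: (leq_trans (ltn_ord (enum_rank v))); rewrite leq_pmull ?subn_gt0.
have CE n : (n <= m)%N -> #|C s n|%:R = #|lex_maps D w m [set: V] 0 n|%:R :> R.
  move=> le_nm; congr _%:R; apply: eq_card => f; rewrite inE.
  apply/and3P/lex_mapsP => [[/forallP f_lt f_prop /eqP f_s]|[f_lt _ fD]].
    split=> [u _|u|u v _ _]; [by left|by rewrite inE|].
    by rewrite /D -f_s inE => /andP[].
  (* [D] orients every edge because [f0] is proper, so a map increasing along [D] orders the ends of
     each edge as [f0] does. *)
  have f_neq u v : e u v || e v u -> (f u < f v)%N = (f0 u < f0 v)%N.
    move=> euv; have := fD u v (in_setT _) (in_setT _).
    have := fD v u (in_setT _) (in_setT _); rewrite !DE euv orbC euv /=.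
    case: (ltngtP (f0 u) (f0 v)) => [_ _ ->|_ /(_ isT)/ltnW + _|/val_inj f0_uv] //.
      by rewrite leqNgt => /negbTE.
    by case/orP: euv => /(implyP (forallP (forallP f0_prop _) _)); rewrite f0_uv eqxx.
  split.
  - by apply/forallP => u; case: (f_lt u (in_setT _)) => // -[].
  - apply/forallP => u; apply/forallP => v; apply/implyP => euv.
    apply: contra (implyP (forallP (forallP f0_prop u) v) euv) => /eqP fuv.
    have := f_neq u v; have := f_neq v u; rewrite euv orbT fuv ltnn.
    move=> /(_ isT) lt_vu /(_ isT) lt_uv.
    by rewrite -val_eqE eqn_leq leqNgt -lt_vu leqNgt -lt_uv.
  rewrite -f0_s; apply/eqP/setP => -[u v]; rewrite !inE /=.
  by case: (boolP (e u v || e v u)) => //= /f_neq.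
rewrite (eq_iter_bdiff _ CE) -cardsT; exact: card_lex_maps_bdiff_ge0.
Qed.

(** * Deletion and contraction *)

Lemma proper_coloringP (V : finType) (e : rel V) n (f : {ffun V -> 'I_n}) :
  reflect (forall u v, e u v -> f u != f v) (proper_coloring e f).
Proof.
apply: (iffP forallP) => [f_prop u v|f_prop u].
  exact/implyP/(forallP (f_prop u)).
by apply/forallP => v; apply/implyP/f_prop.
Qed.

Lemma chromatic_edgeless (V : finType) (e : rel V) n :
  (forall u v, ~~ e u v) -> chromatic e n = (n ^ #|V|)%N.
Proof.
move=> e0; rewrite -[n in RHS]card_ord -card_ffun -cardsT; apply: eq_card => f.
by rewrite !inE; apply/proper_coloringP => u v; rewrite (negPf (e0 u v)).
Qed.

Lemma chromatic_loop (V : finType) (e : rel V) n u : e u u -> chromatic e n = 0%N.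
Proof.
move=> euu; apply/eqP; rewrite cards_eq0; apply/set0Pn => -[f].
by rewrite inE => /proper_coloringP/(_ u u euu); rewrite eqxx.
Qed.

(** Only an ordered pair is dropped, so a symmetric edge takes two deletions; the contraction paired
    with the first has a loop, hence no colorings. *)
Definition delete_edge (V : finType) (e : rel V) (u v : V) : rel V :=
  fun x y => e x y && ((x, y) != (u, v)).

(* e and e' are arbitrary relations: e' may have loops, and it does if e v u. *)
Lemma deletion_contraction (V : finType) (e : rel V) (u v : V) :
  e u v -> u != v ->
  exists2 W : finType, #|W|.+1 = #|V| &
    exists e' : rel W, forall n,
      (chromatic (delete_edge e u v) n = chromatic e n + chromatic e' n)%N.
Proof.
move=> euv ne_uv; pose W : finType := {x : V | x != v}; pose u' : W := Sub u ne_uv.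
have cardW : #|W|.+1 = #|V|.
  rewrite card_sig [RHS](cardD1 v) inE; congr _.+1.
  by apply: eq_card => x; rewrite !inE andbT.
(* [insubd] returns its default at [v], so [r] is the quotient map merging [v] into [u]. *)
exists W => //; pose r : V -> W := insubd u'.
have rv : r v = u' by rewrite /r /insubd insubF ?eqxx.
have rK (x : W) : r (val x) = x by apply: valKd.
have r_val x : x != v -> val (r x) = x by move=> xv; rewrite /r val_insubd xv.
exists (fun x y => [exists a, exists b, [&& r a == x, r b == y & delete_edge e u v a b]]).
move=> n; pose lift (g : {ffun W -> 'I_n}) := [ffun x => g (r x)].
have lift_inj : injective lift.
  move=> g h /ffunP gh; apply/ffunP => x.
  by have := gh (val x); rewrite !ffunE rK.
rewrite /chromatic -(card_imset _ lift_inj).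
(* Colorings after deletion with [f u != f v] are those of [e]; those with [f u = f v] factor
   through [r]. *)
rewrite -(cardsID [set f : {ffun V -> 'I_n} | f u == f v]) addnC; congr (_ + _)%N.
  apply: eq_card => f; rewrite !inE; apply/andP/proper_coloringP => [[fuv]|f_prop].
    move/proper_coloringP => f_prop x y exy.
    have [[-> ->]//|ne_xy] := eqVneq (x, y) (u, v).
    by apply: f_prop; rewrite /delete_edge exy.
  split; first exact: f_prop.
  by apply/proper_coloringP => x y /andP[/f_prop].
apply: eq_card => f; rewrite !inE; apply/andP/imsetP => [[/proper_coloringP f_prop /eqP fuv]
  |[g]].
  have def_f : f = lift [ffun x => f (val x)].
    apply/ffunP => x; rewrite !ffunE; have [->|/r_val -> //] := eqVneq x v.
    by rewrite rv.
  exists [ffun x => f (val x)] => //; rewrite inE; apply/proper_coloringP => x y.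
  case/existsP => a /existsP[b /and3P[/eqP<- /eqP<- /f_prop]].
  by rewrite def_f !ffunE !rK.
rewrite inE => /proper_coloringP g_prop ->; rewrite !ffunE rv -[r u]/(r (val u')) rK eqxx.
split=> //; apply/proper_coloringP => x y exy; rewrite !ffunE; apply: g_prop.
by apply/existsP; exists x; apply/existsP; exists y; rewrite !eqxx.
Qed.

(** * The coefficients of h and the inequalities g_i >= 0 *)

Definition chromatic_hstar (R : nzRingType) (V : finType) (e : rel V) : nat -> R :=
  iter #|V|.+1 bdiff (fun n => (chromatic e n)%:R).

Lemma sum_bdiff (R : zmodType) (u : nat -> R) i :
  \sum_(j < i.+1) bdiff u j = u i.
Proof.
elim: i => [|i IHi]; first by rewrite big_ord1 /bdiff subr0.
by rewrite big_ord_recr /= IHi /bdiff /= addrC subrK.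
Qed.

Lemma sum_bdiff_rev (R : zmodType) (u : nat -> R) d i :
  (i <= d)%N -> \sum_(j < i) bdiff u (d - j) = u d - u (d - i)%N.
Proof.
elim: i => [|i IHi] lt_id; first by rewrite big_ord0 subn0 subrr.
rewrite big_ord_recr /= (IHi (ltnW lt_id)) /bdiff -[(d - i)%N]prednK ?subn_gt0 //=.
by rewrite -subnS addrA subrK.
Qed.

Definition hstar_gap (R : zmodType) (u : nat -> R) (d i : nat) : R :=
  \sum_(j < i) (u (d - j)%N - u j).

Lemma eulerian_ge0 (R : numDomainType) d m : 0 <= eulerian R d m.
Proof.
elim: d m => [|d IHd] m; first by rewrite eulerian00 ler0n.
have [lt_dm|le_md] := ltnP d.+1 m; first by rewrite eulerian_gt.
rewrite eulerianS addr_ge0 ?mulr_ge0 ?ler0n // ?subr_ge0 ?ler_nat ?(leqW le_md) //.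
by case: m le_md => [|m] _ /=.
Qed.

(** For d > 0 the symmetry turns the entry at d - j into the one at j + 1, and the gap
    telescopes. *)
Lemma eulerian_gap_ge0 (R : numDomainType) d i :
  (i <= d.+1)%N -> 0 <= hstar_gap (eulerian R d) d i.
Proof.
case: d => [|d] le_id.
  rewrite /hstar_gap big1 // => -[j lt_ji] _ /=.
  by case: j lt_ji => [|j]; rewrite ?subrr //; lia.
suff -> : hstar_gap (eulerian R d.+1) d.+1 i = eulerian R d.+1 i.
  exact: eulerian_ge0.
have e0 : eulerian R d.+1 0 = 0 by rewrite eulerianS /= mul0r mulr0 addr0.
elim: i le_id => [|i IHi] lt_id; first by rewrite /hstar_gap big_ord0 e0.
rewrite /hstar_gap big_ord_recr /= -/(hstar_gap _ _ _) IHi ?(ltnW lt_id) //.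
rewrite addrC subrK eulerian_sym; last by rewrite (leq_trans (leq_subr _ _)).
by congr eulerian; lia.
Qed.

(** Nested induction: on the number of vertices for contraction, then on the number of ordered pairs
    for deletion. The vanishing part for the contraction feeds the gap estimate. *)
Lemma chromatic_hstarP (R : realDomainType) (V : finType) (e : rel V) :
  (forall m, (#|V| < m)%N -> chromatic_hstar R e m = 0) /\
  (forall i, (i <= #|V|.+1)%N -> 0 <= hstar_gap (chromatic_hstar R e) #|V| i).
Proof.
have [n Vn] := ubnP #|V|; elim: n => // n IHn in V e Vn *.
move Ek: #|[set p | e p.1 p.2]| => k; elim: k => [|k IHk] in e Ek *.
  have hE m : chromatic_hstar R e m = eulerian R #|V| m.
    apply: eq_iter_bdiff => i _; rewrite chromatic_edgeless // => {i}u v.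
    by have := cards0_eq Ek; move/setP/(_ (u, v)); rewrite !inE => ->.
  split=> [m lt_Vm|i le_iV]; first by rewrite hE eulerian_gt.
  rewrite /hstar_gap; under eq_bigr do rewrite !hE.
  exact: eulerian_gap_ge0.
have /set0Pn[[u v]] : [set p | e p.1 p.2] != set0 by rewrite -card_gt0 Ek.
rewrite inE /= => euv.
have [uv|ne_uv] := eqVneq u v.
  have h0 m : chromatic_hstar R e m = 0.
    rewrite -[RHS](iter_bdiff0 R #|V|.+1 m); apply: eq_iter_bdiff => j _.
    by rewrite (chromatic_loop j (u := u)) // {2}uv.
  split=> // i _; rewrite /hstar_gap big1 // => j _; by rewrite !h0 subrr.
have [W cardW [e' dc]] := deletion_contraction euv ne_uv.
have [|W0 _] := IHn W e'; first by rewrite cardW.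
have Ek' : #|[set p | delete_edge e u v p.1 p.2]| = k.
  have := cardsD1 (u, v) [set p | e p.1 p.2]; rewrite Ek inE euv => -[->].
  by apply: eq_card => -[x y]; rewrite !inE /= /delete_edge andbC.
have [V0 Vgap] := IHk _ Ek'.
move: V0 Vgap; rewrite -cardW; move: #|W| (erefl #|W|) W0 => d cardWd W0 V0 Vgap.
(* The contraction has one vertex less, so its coefficients need one more [bdiff]. *)
have hE m : chromatic_hstar R e m =
    chromatic_hstar R (delete_edge e u v) m - bdiff (chromatic_hstar R e') m.
  rewrite /chromatic_hstar -cardW -iterS -iter_bdiffN -iter_bdiffD.
  by apply: eq_iter_bdiff => j _; rewrite dc natrD addrK.
split=> [m lt_dm|i le_id].
  rewrite hE V0 // /bdiff; case: m lt_dm => //= m lt_dm.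
  by rewrite !W0 ?subrr // ltnW.
have -> : hstar_gap (chromatic_hstar R e) d.+1 i =
    hstar_gap (chromatic_hstar R (delete_edge e u v)) d.+1 i
    + (\sum_(j < i) bdiff (chromatic_hstar R e') j
       - \sum_(j < i) bdiff (chromatic_hstar R e') (d.+1 - j)).
  rewrite /hstar_gap -!(sumrB, big_split) /=; apply: eq_bigr => j _; rewrite !hE.
  by ring.
rewrite addr_ge0 ?Vgap //; case: i le_id => [|i]; first by rewrite !big_ord0 subrr.
have h'_ge0 m : 0 <= chromatic_hstar R e' m by apply: chromatic_bdiff_ge0.
(* With d = [#|W|] and h' for [e'], the telescoped sums add h'_i + h'_(d-i) for i <= d; at i = d + 1
   both equal h'_(d+1) = 0. *)
rewrite ltnS sum_bdiff leq_eqVlt => /orP[/eqP->|le_id].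
  by rewrite big_ord_recr /= sum_bdiff_rev // subnn W0 // /bdiff /= subr0 subrK subr0.
by rewrite sum_bdiff_rev // (W0 d.+1) // sub0r opprK addr_ge0.
Qed.

(** * Symmetry and the decomposition *)

Lemma self_reciprocal_coef (R : fieldType) k (p : {poly R}) :
  (size p <= k.+1)%N -> (forall i, (i <= k)%N -> p`_i = p`_(k - i)) ->
  self_reciprocal k p.
Proof.
move=> size_p p_sym z z0; rewrite !(horner_coef_wide _ size_p).
rewrite (reindex_inj rev_ord_inj) mulr_sumr; apply: eq_bigr => i _ /=.
rewrite subSS -p_sym ?leq_ord // mulrCA; congr (_ * _).
by rewrite exprVn expfB_cond // (negPf z0) leq_ord.
Qed.

Lemma hstar_gapS (R : zmodType) (u : nat -> R) d i :
  hstar_gap u d i.+1 = hstar_gap u d i + (u (d - i)%N - u i).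
Proof. by rewrite /hstar_gap big_ord_recr. Qed.

Lemma hstar_gap0 (R : zmodType) (u : nat -> R) d : hstar_gap u d 0 = 0.
Proof. by rewrite /hstar_gap big_ord0. Qed.

(** The summands change sign under j -> d - j, so the full sum is 0 and complementary partial sums
    agree. *)
Lemma hstar_gap_sym (R : zmodType) (u : nat -> R) d i :
  (i <= d.+1)%N -> hstar_gap u d (d.+1 - i) = hstar_gap u d i.
Proof.
have full : hstar_gap u d d.+1 = 0.
  rewrite /hstar_gap sumrB (reindex_inj rev_ord_inj) /=; apply/eqP.
  by rewrite subr_eq0; apply/eqP/eq_bigr => j _; rewrite subSS subKn ?leq_ord.
elim: i => [|i IHi] lt_id; first by rewrite subn0 full hstar_gap0.
rewrite hstar_gapS -IHi ?(ltnW lt_id) // [(d.+1 - i)%N]subSn // hstar_gapS subSS.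
by rewrite subKn // -[u i - _]opprB subrK.
Qed.

Theorem theorem1p3 (R : realFieldType) (V : finType) (e : rel V) (d : nat)
    (e_sym : symmetric e) (e_irr : irreflexive e) (card_V : #|V| = d)
    (h : {poly R})
    (h_def : gen_series_eq_frac (fun n => (chromatic e n)%:R) h
               ((1 - 'X) ^+ d.+1)) :
  exists a b : {poly R},
    [/\ 'X * h = a + 'X * b,
        self_reciprocal d.+1 a,
        self_reciprocal d b,
        forall i : nat, 0 <= b`_i
      & forall i : nat, 0 <= (- a)`_i].
Proof.
pose u := chromatic_hstar R e; pose g := hstar_gap u d.
have hE i : h`_i = u i by rewrite /u /chromatic_hstar card_V -iter_bdiff_conv -h_def.
have [u_gt g_ge0] : (forall i, (d < i)%N -> u i = 0)
    /\ (forall i, (i <= d.+1)%N -> 0 <= g i).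
  by rewrite /g -card_V; apply: chromatic_hstarP.
have u_ge0 i : 0 <= u i by apply: chromatic_bdiff_ge0.
have g_sym i : (i <= d.+1)%N -> g (d.+1 - i)%N = g i by apply: hstar_gap_sym.
have g_top : g d.+1 = 0 by have := g_sym 0%N isT; rewrite subn0 {2}/g hstar_gap0.
(* Cutting [a] off after degree d loses nothing, since [g d.+1] is 0 by [g_top]. *)
exists (- \poly_(i < d.+1) g i), (\poly_(i < d.+1) (g i + u (d - i)%N)).
split.
- apply/polyP => -[|i]; rewrite coefD coefN !coefXM !coef_poly /= ?hE.
    by rewrite /g hstar_gap0 oppr0 addr0.
  rewrite !ltnS; have gS : g i.+1 = g i + (u (d - i)%N - u i) by apply: hstar_gapS.
  case: (ltngtP i d) => [lt_id|lt_di|eq_id].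
  - by rewrite gS; ring.
  - by rewrite u_gt // oppr0 addr0.
  by move: gS; rewrite eq_id g_top => /eqP; rewrite eq_sym addrA subr_eq0 => /eqP->; ring.
- apply: self_reciprocal_coef => [|i le_id].
    by rewrite size_polyN (leq_trans (size_poly _ _)).
  rewrite !coefN !coef_poly; congr (- _); case: ltnP => le_di.
    case: ltnP => [_|le_d]; first by rewrite g_sym.
    (* The mirror index d + 1 is beyond the cut-off, where the coefficient is 0 by default; [g 0] is
       0 too. *)
    have -> : i = 0%N by lia.
    by rewrite /g hstar_gap0.
  have -> : i = d.+1 by lia.
  by rewrite subnn /= /g hstar_gap0.
- apply: self_reciprocal_coef => [|i le_id]; first exact: size_poly.
  (* Uses g_i = g_(d-i+1) = g_(d-i) + u_i - u_(d-i). *)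
  rewrite !coef_poly !ltnS le_id leq_subr subKn // -g_sym ?(leqW le_id) //.
  by rewrite subSn // /g hstar_gapS subKn // -addrA subrK.
- move=> i; rewrite coef_poly; case: ifP => // le_id.
  by rewrite addr_ge0 ?g_ge0 // ltnW.
move=> i; rewrite opprK coef_poly; case: ifP => // le_id.
by rewrite g_ge0 // ltnW.
Qed.
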